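(* Consider on the half-line graph $\mathbb{N}$ quantum metrics of the form $$g=\sum_{i\ge1}h_i\big(\phi_i\,a_i\otimes a_i'+\epsilon\,a_i'\otimes a_i\big),\qquad h_i,\phi_i\ne 0,\quad \epsilon=\pm1 .$$ For any such quantum metric described by $(h_i)_{i\ge1}$ and $\epsilon$, there is a 1-parameter moduli of allowed direction coefficients $\phi_i$ and a 1-parameter family of quantum Levi-Civita connections (QLCs), as defined iteratively by $$\phi_{i+1}=\phi_1-\frac1{\phi_i},\qquad \tau_{i+1}=-1+\frac{\phi_{i+1}}{\phi_i+\epsilon\tau_i}$$ for arbitrary $\phi_1,\tau_1\neq0$. The other connection coefficients are then given by $$\sigma_i=\frac{h_{i+1}\phi_{i+1}}{h_i\phi_i(1+\tau_i')},\qquad \sigma_i'=\frac{h_{i-1}(\phi_{i-1}+\epsilon\tau_{i-1})}{h_i\phi_i},\qquad \tau_i'=\epsilon\,\frac{\phi_i-\phi_{i+1}}{\tau_i}.$$ Moreover, for $h_i,\phi_1$ real, the connection is $*$-preserving if and only if $|\tau_1|=1$.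
   Context: Scalars are complex numbers. **Calculus.** $\mathbb{N}=\{1,2,3,\dots\}$ is the graph with an edge $i - (i+1)$ for each $i\ge1$. $A=\mathbb{C}(\mathbb{N})$ is the algebra of complex functions on the vertices. $\Omega^1$ is the space of all (possibly infinite) linear combinations of the arrows $a_i=\omega_{i\to i+1}$ and $a_i'=\omega_{i+1\to i}$, $i\ge1$. It is an $A$-bimodule via $f a_i=f(i)a_i$, $a_i f=f(i+1)a_i$, $f a_i'=f(i+1)a_i'$, $a_i'f=f(i)a_i'$, with exterior derivative $\mathrm{d}f=\sum_i (f(i+1)-f(i))(a_i-a_i')$. $\Omega^1\otimes_A\Omega^1$ consists of (possibly infinite) linear combinations of 2-step paths $a_i\otimes a_{i+1}$, $a_{i+1}'\otimes a_i'$, $a_i\otimes a_i'$, $a_i'\otimes a_i$ ($\otimes$ means $\otimes_A$), and similarly for more factors. $\Omega^2$ is the quotient of $\Omega^1\otimes_A\Omega^1$ (with quotient map $\wedge$) by the relations $a_i\wedge a_{i+1}=0$, $a_{i+1}'\wedge a_i'=0$, $a_1\wedge a_1'=0$, $a_{i+1}\wedge a_{i+1}'+a_i'\wedge a_i=0$ for $i\ge1$. With $\theta=\sum_i(a_i+a_i')$, $\mathrm{d}:\Omega^1\to\Omega^2$ is $\mathrm{d}\omega=\theta\wedge\omega+\omega\wedge\theta$. The $\phi_i$ in $g$ are called direction coefficients. **Connections.** A bimodule connection on $\Omega^1$ is a linear map $\nabla:\Omega^1\to\Omega^1\otimes_A\Omega^1$ together with a bimodule map $\sigma:\Omega^1\otimes_A\Omega^1\to\Omega^1\otimes_A\Omega^1$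 such that $\nabla(f\omega)=\mathrm{d}f\otimes\omega+f\nabla\omega$ and $\nabla(\omega f)=(\nabla\omega)f+\sigma(\omega\otimes\mathrm{d}f)$. It extends to tensor products by $\nabla(\omega\otimes\eta)=\nabla\omega\otimes\eta+(\sigma(\omega\otimes(\ ))\otimes\mathrm{id})\nabla\eta$. It is a quantum Levi-Civita connection (QLC) for $g$ if $\wedge\nabla=\mathrm{d}$ on $\Omega^1$ (torsion free) and $\nabla g=0$. **Connection coefficients.** The connection with coefficients $\tau_i,\tau_i',\sigma_i$ ($i\ge1$), $\sigma_i'$ ($i\ge2$) is $\nabla\omega=\theta\otimes\omega-\sigma(\omega\otimes\theta)$ with $\sigma(a_i\otimes a_{i+1})=\sigma_i\,a_i\otimes a_{i+1}$; $\sigma(a_i'\otimes a_{i-1}')=\sigma_i'\,a_i'\otimes a_{i-1}'$ ($i\ge2$); $\sigma(a_1\otimes a_1')=\tau_1\,a_1\otimes a_1'$; $\sigma(a_i\otimes a_i')=\tau_i\,a_i\otimes a_i'+(1+\tau_i)\,a_{i-1}'\otimes a_{i-1}$ ($i\ge2$); $\sigma(a_i'\otimes a_i)=\tau_i'\,a_i'\otimes a_i+(1+\tau_i')\,a_{i+1}\otimes a_{i+1}'$ ($i\ge 1$). **$*$-structure.** $f^*=\bar f$, $a_i^*=-a_i'$, $a_i'^*=-a_i$ extended antilinearly; $(\omega\otimes\eta)^\dagger=\eta^*\otimes\omega^*$. $\nabla$ is $*$-preserving if $\nabla\circ *=\sigma\circ\dagger\circ\nabla$.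
   Formalization: ''Arbitrary φ_1, τ_1 ≠ 0'' is read as: all φ_i ≠ 0 and no denominator τ_i, φ_i+ετ_i, 1+τ_i' vanishes (φ_1=1 gives φ_2=0; τ_1=−εφ_1 leaves τ_2 undefined); the excluded φ_1, and for given φ the excluded τ_1, are proved countable, and no QLC is lost. *)

(* Defs.v *)
From mathcomp Require Import all_boot all_order all_algebra complex.
From mathcomp Require Import boolp classical_sets functions cardinality reals.

Set Implicit Arguments.
Unset Strict Implicit.
Unset Printing Implicit Defensive.

Import Order.TTheory GRing.Theory Num.Theory.
Local Open Scope ring_scope.

(* The half-line graph has vertices 1, 2, 3, ...; here the vertex i is encoded
   by the natural number i - 1.  All sequences are shifted in the same way, so
   that [a n] and [h n] below stand for a_{n+1} and h_{n+1}.

   The arrow [(n, true)] is a_{n+1} (from the vertex encoded by n to the one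
   encoded by n.+1), and [(n, false)] is a'_{n+1}, its reverse. *)
Definition arrow := (nat * bool)%type.
Definition src (e : arrow) : nat := if e.2 then e.1 else e.1.+1.
Definition tgt (e : arrow) : nat := if e.2 then e.1.+1 else e.1.
Definition rev_arrow (e : arrow) : arrow := (e.1, ~~ e.2).

Definition path2 := {p : arrow * arrow | tgt p.1 == src p.2}.
Definition path3 := {p : arrow * arrow * arrow |
  (tgt p.1.1 == src p.1.2) && (tgt p.1.2 == src p.2)}.

Definition head1 (p : path2) : arrow := (val p).1.
Definition last1 (p : path2) : arrow := (val p).2.

Lemma init2_subproof (p : path3) : tgt (val p).1.1 == src (val p).1.2.
Proof. by case/andP: (valP p). Qed.
Definition init2 (p : path3) : path2 :=
  exist (fun q : arrow * arrow => tgt q.1 == src q.2)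
        ((val p).1.1, (val p).1.2) (init2_subproof p).

Lemma tail2_subproof (p : path3) : tgt (val p).1.2 == src (val p).2.
Proof. by case/andP: (valP p). Qed.
Definition tail2 (p : path3) : path2 :=
  exist (fun q : arrow * arrow => tgt q.1 == src q.2)
        ((val p).1.2, (val p).2) (tail2_subproof p).

Lemma rev2_subproof (p : path2) :
  tgt (rev_arrow (last1 p)) == src (rev_arrow (head1 p)).
Proof.
case: p => [[[m b] [n c]] /=]; rewrite /tgt /src /rev_arrow /=.
by case: b; case: c; rewrite eq_sym.
Qed.
Definition rev2 (p : path2) : path2 :=
  exist (fun q : arrow * arrow => tgt q.1 == src q.2)
        (rev_arrow (last1 p), rev_arrow (head1 p)) (rev2_subproof p).

Definition mk2 (e f : arrow) (H : tgt e == src f) : path2 :=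
  exist (fun q : arrow * arrow => tgt q.1 == src q.2) (e, f) H.

(* With i = n + 1 these are the paths a_i (x) a_{i+1}, a'_{i+1} (x) a'_i,
   a_i (x) a'_i and a'_i (x) a_i. *)
Definition uu (n : nat) : path2 := @mk2 (n, true) (n.+1, true) (eqxx n.+1).
Definition dd (n : nat) : path2 := @mk2 (n.+1, false) (n, false) (eqxx n.+1).
Definition ud (n : nat) : path2 := @mk2 (n, true) (n, false) (eqxx n.+1).
Definition du (n : nat) : path2 := @mk2 (n, false) (n, true) (eqxx n).

Section Calculus.
Variable R : realType.
Local Notation C := (R[i]).

(* Infinite linear combinations of paths are functions from paths to C.  [C^o]
   is C as a module over itself; the pointwise module structure on functions
   is the canonical one.  Since every vertex has finitely many incoming and
   outgoing arrows, [Omega11] and [Omega111] are the tensor products over A of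
   two and three copies of [Omega1] (see [Omega11_decomp]). *)
Definition Omega1 := arrow -> C^o.
Definition Omega11 := path2 -> C^o.
Definition Omega111 := path3 -> C^o.

Definition lact1 (f : nat -> C) (w : Omega1) : Omega1 :=
  fun e => f (src e) * w e.
Definition ract1 (w : Omega1) (f : nat -> C) : Omega1 :=
  fun e => w e * f (tgt e).
Definition lact2 (f : nat -> C) (x : Omega11) : Omega11 :=
  fun p => f (src (head1 p)) * x p.
Definition ract2 (x : Omega11) (f : nat -> C) : Omega11 :=
  fun p => x p * f (tgt (last1 p)).

Definition tens (w v : Omega1) : Omega11 := fun p => w (head1 p) * v (last1 p).
Definition tens21 (x : Omega11) (v : Omega1) : Omega111 :=
  fun p => x (init2 p) * v (val p).2.
Definition tens12 (w : Omega1) (x : Omega11) : Omega111 :=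
  fun p => w (val p).1.1 * x (tail2 p).

Definition diff0 (f : nat -> C) : Omega1 := fun e => f (tgt e) - f (src e).

Definition theta : Omega1 := fun _ => 1.

(* The sum over n of
   cuu n * uu n + cdd n * dd n + cud n * ud n + cdu n * du n. *)
Definition path_sum (cuu cdd cud cdu : nat -> C) : Omega11 := fun p =>
  match val p with
  | ((n, true), (_, true)) => cuu n
  | ((_, false), (n, false)) => cdd n
  | ((n, true), (_, false)) => cud n
  | ((n, false), (_, true)) => cdu n
  end.

(* The kernel of the wedge product, spanned (with infinite sums) by
   a_i (x) a_{i+1}, a'_{i+1} (x) a'_i, a_1 (x) a'_1 and
   a_{i+1} (x) a'_{i+1} + a'_i (x) a_i.  Omega^2 is the quotient of [Omega11]
   by it. *)
Definition wedge_relations (x : Omega11) : Prop :=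
  exists (b c e : nat -> C) (t : C),
    x = path_sum b c (fun n => if n is m.+1 then e m else t) e.

Definition eq_Omega2 (x y : Omega11) : Prop := wedge_relations (x - y).

(* A representative in [Omega11] of d w in Omega^2. *)
Definition diff1 (w : Omega1) : Omega11 := tens theta w + tens w theta.

Definition bimodule_map (sigma : Omega11 -> Omega11) : Prop :=
  [/\ linear sigma,
      forall f x, sigma (lact2 f x) = lact2 f (sigma x)
    & forall x f, sigma (ract2 x f) = ract2 (sigma x) f].

Definition bimodule_connection (nabla : Omega1 -> Omega11)
    (sigma : Omega11 -> Omega11) : Prop :=
  [/\ linear nabla,
      bimodule_map sigma,
      forall f w, nabla (lact1 f w) = tens (diff0 f) w + lact2 f (nabla w)
    & forall w f,
        nabla (ract1 w f) = ract2 (nabla w) f + sigma (tens w (diff0 f))].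

(* [slice e x] is the y such that y (x) e is the part of x made of the paths
   with last arrow e. *)
Definition slice (e : arrow) (x : Omega111) : Omega11 :=
  fun q => if insub (val q, e) is Some p then x p else 0.

(* sigma (x) id *)
Definition sigma12 (sigma : Omega11 -> Omega11) (x : Omega111) : Omega111 :=
  fun p => sigma (slice (val p).2 x) (init2 p).

(* [D] is the extension of the connection to [Omega11]; by [Omega11_decomp] it
   is determined by these conditions. *)
Definition tensor_extension (nabla : Omega1 -> Omega11)
    (sigma : Omega11 -> Omega11) (D : Omega11 -> Omega111) : Prop :=
  linear D /\
  forall w v, D (tens w v) =
    tens21 (nabla w) v + sigma12 sigma (tens12 w (nabla v)).

Definition torsion_free (nabla : Omega1 -> Omega11) : Prop :=
  forall w, eq_Omega2 (nabla w) (diff1 w).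

Definition metric_compatible (nabla : Omega1 -> Omega11)
    (sigma : Omega11 -> Omega11) (g : Omega11) : Prop :=
  exists D, tensor_extension nabla sigma D /\ D g = 0.

Definition QLC (g : Omega11) (nabla : Omega1 -> Omega11)
    (sigma : Omega11 -> Omega11) : Prop :=
  [/\ bimodule_connection nabla sigma,
      torsion_free nabla
    & metric_compatible nabla sigma g].

Definition metric (h phi : nat -> C) (eps : C) : Omega11 :=
  path_sum (fun=> 0) (fun=> 0) (fun n => h n * phi n) (fun n => h n * eps).

(* The connection with given coefficients.  The formula for sigma x collects
   the coefficients of the images of the basis paths, which are computed in
   [coeff_sigma_uu], ..., [coeff_sigma_du].  As sigma'_i is indexed by i >= 2,
   the value [s' 0] is not used. *)
Definition coeff_sigma (tau tau' s s' : nat -> C) (x : Omega11) : Omega11 :=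
  path_sum (fun n => s n * x (uu n))
           (fun n => s' n.+1 * x (dd n))
           (fun n => tau n * x (ud n)
                     + (if n is m.+1 then (1 + tau' m) * x (du m) else 0))
           (fun n => tau' n * x (du n) + (1 + tau n.+1) * x (ud n.+1)).

Definition coeff_nabla (tau tau' s s' : nat -> C) (w : Omega1) : Omega11 :=
  tens theta w - coeff_sigma tau tau' s s' (tens w theta).

(* Extended antilinearly from a_i^* = - a'_i and a'_i^* = - a_i. *)
Definition star (w : Omega1) : Omega1 := fun e => - Num.conj (w (rev_arrow e)).

(* Extended antilinearly from (e (x) f)^dagger = f^* (x) e^*; the two signs of
   the star cancel. *)
Definition dagger (x : Omega11) : Omega11 := fun p => Num.conj (x (rev2 p)).

Definition star_preserving (nabla : Omega1 -> Omega11)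
    (sigma : Omega11 -> Omega11) : Prop :=
  forall w, nabla (star w) = sigma (dagger (nabla w)).

Fixpoint phi_of (phi1 : C) (n : nat) : C :=
  if n is m.+1 then phi1 - 1 / phi_of phi1 m else phi1.

Fixpoint tau_of (eps : C) (phi : nat -> C) (tau1 : C) (n : nat) : C :=
  if n is m.+1 then - 1 + phi m.+1 / (phi m + eps * tau_of eps phi tau1 m)
  else tau1.

Definition tau'_of (eps : C) (phi tau : nat -> C) (n : nat) : C :=
  eps * ((phi n - phi n.+1) / tau n).

Definition sigma_of (h : nat -> C) (eps : C) (phi tau : nat -> C) (n : nat) :
    C :=
  h n.+1 * phi n.+1 / (h n * phi n * (1 + tau'_of eps phi tau n)).

Definition sigma'_of (h : nat -> C) (eps : C) (phi tau : nat -> C) (n : nat) :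
    C :=
  h n.-1 * (phi n.-1 + eps * tau n.-1) / (h n * phi n).

(* Division by 0 is total in MathComp; this says that, for nonzero h and phi,
   no denominator vanishes in the above formulas. *)
Definition well_defined (eps : C) (phi tau : nat -> C) : Prop :=
  forall n, [/\ tau n != 0, phi n + eps * tau n != 0
              & 1 + tau'_of eps phi tau n != 0].

Definition family_nabla (h : nat -> C) (eps : C) (phi : nat -> C) (tau1 : C) :
    Omega1 -> Omega11 :=
  let tau := tau_of eps phi tau1 in
  coeff_nabla tau (tau'_of eps phi tau) (sigma_of h eps phi tau)
              (sigma'_of h eps phi tau).

Definition family_sigma (h : nat -> C) (eps : C) (phi : nat -> C) (tau1 : C) :
    Omega11 -> Omega11 :=
  let tau := tau_of eps phi tau1 in
  coeff_sigma tau (tau'_of eps phi tau) (sigma_of h eps phi tau)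
              (sigma'_of h eps phi tau).

Lemma path2_cases (P : path2 -> Prop) :
  (forall n, P (uu n)) -> (forall n, P (dd n)) -> (forall n, P (ud n)) ->
  (forall n, P (du n)) -> forall p, P p.
Proof.
move=> Puu Pdd Pud Pdu [[[m []] [n []]] mn]; rewrite -[exist _ _ _]/(mk2 mn);
  have := eqP mn; rewrite /src /tgt /= => mnE.
- by have -> : mk2 mn = uu m by apply: val_inj; rewrite /= mnE.
- case: mnE => mnE.
  by have -> : mk2 mn = ud m by apply: val_inj; rewrite /= mnE.
- by have -> : mk2 mn = du m by apply: val_inj; rewrite /= mnE.
- by have -> : mk2 mn = dd n by apply: val_inj; rewrite /= mnE.
Qed.

Lemma path2P (x y : Omega11) :
  (forall n, [/\ x (uu n) = y (uu n), x (dd n) = y (dd n),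
                 x (ud n) = y (ud n) & x (du n) = y (du n)]) -> x = y.
Proof. by move=> xy; apply/funext; apply: path2_cases => n; case: (xy n). Qed.

Lemma Omega11_decomp (x : Omega11) :
  exists w v : Omega1,
    x = tens w (fun e => (e.2)%:R) + tens v (fun e => (~~ e.2)%:R).
Proof.
exists (fun e => match e with
          | (n, true) => x (uu n) | (n, false) => x (du n) end).
exists (fun e => match e with
          | (n, true) => x (ud n)
          | (n, false) => if n is m.+1 then x (dd m) else 0 end).
apply: path2P => n; rewrite /tens /GRing.add /=.
by split; rewrite /= !(mulr1, mulr0) ?addr0 ?add0r.
Qed.

Definition basis2 (p : path2) : Omega11 := fun q => (q == p)%:R.

Section CoeffSigma.
Variables tau tau' s s' : nat -> C.
Local Notation sigma := (coeff_sigma tau tau' s s').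

Let addE (x y : Omega11) p : (x + y) p = x p + y p. Proof. by []. Qed.
Let scaleE (c : C) (x : Omega11) p : (c *: x) p = c * x p. Proof. by []. Qed.
Let basisE p q : basis2 p q = (val q == val p)%:R. Proof. by []. Qed.
Let arrowE (m n : nat) (b c : bool) :
  ((m, b) == (n, c) :> arrow) = (m == n) && (b == c).
Proof. by []. Qed.
Let pairE (e f e' f' : arrow) : ((e, f) == (e', f')) = (e == e') && (f == f').
Proof. by []. Qed.
Let simpE := (addE, scaleE, basisE, pairE, arrowE, andbT, andbF, andbb,
  mulr0, mulr1, addr0, add0r, eqSS).

Lemma coeff_sigma_uu n : sigma (basis2 (uu n)) = s n *: basis2 (uu n).
Proof.
apply: path2P => -[|k]; rewrite !simpE /coeff_sigma /path_sum /= !simpE;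
  by split=> //; case: eqP => [<-|_]; rewrite ?mulr0.
Qed.

Lemma coeff_sigma_dd n : sigma (basis2 (dd n)) = s' n.+1 *: basis2 (dd n).
Proof.
apply: path2P => -[|k]; rewrite !simpE /coeff_sigma /path_sum /= !simpE;
  by split=> //; case: eqP => [<-|_]; rewrite ?mulr0.
Qed.

Lemma coeff_sigma_ud0 : sigma (basis2 (ud 0)) = tau 0 *: basis2 (ud 0).
Proof.
apply: path2P => -[|k]; rewrite !simpE /coeff_sigma /path_sum /= !simpE;
  by split=> //; case: eqP => [<-|_]; rewrite ?mulr0.
Qed.

Lemma coeff_sigma_udS n : sigma (basis2 (ud n.+1)) =
  tau n.+1 *: basis2 (ud n.+1) + (1 + tau n.+1) *: basis2 (du n).
Proof.
apply: path2P => -[|k]; rewrite !simpE /coeff_sigma /path_sum /= !simpE;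
  by split=> //; case: eqP => [<-|_]; rewrite ?mulr0.
Qed.

Lemma coeff_sigma_du n : sigma (basis2 (du n)) =
  tau' n *: basis2 (du n) + (1 + tau' n) *: basis2 (ud n.+1).
Proof.
apply: path2P => -[|k]; rewrite !simpE /coeff_sigma /path_sum /= !simpE;
  by split=> //; case: eqP => [<-|_]; rewrite ?mulr0.
Qed.

End CoeffSigma.
End Calculus.

(* Main.v *)
(* Bimodule maps are local: the coefficient of the image at a path only depends
   on the coefficients at the paths with the same endpoints.  As no arrow shares
   its endpoints with a path of length 2, a bimodule connection is determined by
   its sigma, and freeness of torsion leaves for sigma exactly the coefficients
   tau, tau', s, s'.  Then nabla g = theta (x) g - s1 s2 (g (x) theta), with
   s1 = sigma (x) id and s2 = id (x) sigma, and its vanishing is a system of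
   equations in these coefficients.  Two of them give tau'_i tau_i =
   eps (phi_i - phi_{i+1}) and, for i > 1, tau'_i tau_i =
   eps (1 / phi_i - 1 / phi_{i-1}), so that phi_{i+1} + 1 / phi_i is constant;
   the others then determine everything from phi_1 and tau_1.

   The exceptional phi_1 are roots of countably many polynomials, since
   phi_i = U_i / U_{i-1} for U_{i+1} = phi_1 U_i - U_{i-1}.  The exceptional
   tau_1 are countably many since tau_i is an injective function of tau_1 as
   long as it is defined.  For real coefficients, |tau_1| = 1 propagates to
   |tau_i|^2 = phi_i (phi_i - phi_{i+1}), from which the *-compatibility
   conditions follow. *)
Require Import Defs.
From mathcomp Require Import all_boot all_order all_algebra complex.
From mathcomp Require Import boolp classical_sets functions cardinality reals.
From mathcomp Require Import ring zify.
From mathcomp Require lebesgue_measure.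

Set Implicit Arguments.
Unset Strict Implicit.
Unset Printing Implicit Defensive.

Import Order.TTheory GRing.Theory Num.Theory.
Local Open Scope classical_set_scope.
Local Open Scope ring_scope.

(** * Connections and their coefficients *)

Lemma init2_of (p : path3) (q : path2) : val q = (val p).1 -> init2 p = q.
Proof. by move=> qE; apply: val_inj; rewrite qE /=; case: (val p).1. Qed.

Lemma tail2_of (p : path3) (q : path2) :
  val q = ((val p).1.2, (val p).2) -> tail2 p = q.
Proof. by move=> qE; apply: val_inj; rewrite qE. Qed.

Definition mk3 (e f g : arrow) (H : (tgt e == src f) && (tgt f == src g)) :
  path3 := exist (fun p : arrow * arrow * arrow =>
    (tgt p.1.1 == src p.1.2) && (tgt p.1.2 == src p.2)) ((e, f), g) H.

Lemma eqxx2 (m n : nat) : (m == m) && (n == n).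
Proof. by rewrite !eqxx. Qed.

(** The letters spell the steps up and down the half-line, and [n] encodes the lowest vertex
    visited. *)
Definition uuu n : path3 :=
  @mk3 (n, true) (n.+1, true) (n.+2, true) (eqxx2 _ _).
Definition uud n : path3 :=
  @mk3 (n, true) (n.+1, true) (n.+1, false) (eqxx2 _ _).
Definition udu n : path3 :=
  @mk3 (n, true) (n, false) (n, true) (eqxx2 _ _).
Definition udd n : path3 :=
  @mk3 (n.+1, true) (n.+1, false) (n, false) (eqxx2 _ _).
Definition duu n : path3 :=
  @mk3 (n, false) (n, true) (n.+1, true) (eqxx2 _ _).
Definition dud n : path3 :=
  @mk3 (n, false) (n, true) (n, false) (eqxx2 _ _).
Definition ddu n : path3 :=
  @mk3 (n.+1, false) (n, false) (n, true) (eqxx2 _ _).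
Definition ddd n : path3 :=
  @mk3 (n.+2, false) (n.+1, false) (n, false) (eqxx2 _ _).

Lemma path3_cases (P : path3 -> Prop) :
  (forall n, P (uuu n)) -> (forall n, P (uud n)) -> (forall n, P (udu n)) ->
  (forall n, P (udd n)) -> (forall n, P (duu n)) -> (forall n, P (dud n)) ->
  (forall n, P (ddu n)) -> (forall n, P (ddd n)) -> forall p, P p.
Proof.
move=> P1 P2 P3 P4 P5 P6 P7 P8 p; have := valP p.
case E: (val p) => [[[k b] [m c]] [n d]]; rewrite /src /tgt /=.
move=> /andP[/eqP + /eqP]; case: b c d E => [] [] [] E /= e1 e2.
- have -> : p = uuu k; last by [].
  by apply: val_inj; rewrite E; rewrite /= -e2 -e1.
- have -> : p = uud k; last by [].
  by apply: val_inj; rewrite E; case: e2 => <- /=; rewrite -e1.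
- have -> : p = udu k; last by [].
  by apply: val_inj; rewrite E; case: e1 => e1; rewrite /= -e2 -e1.
- have -> : p = udd n; last by [].
  by apply: val_inj; rewrite E; case: e1 => e1; rewrite /= e1 e2.
- have -> : p = duu k; last by [].
  by apply: val_inj; rewrite E; rewrite /= -e2 -e1.
- have -> : p = dud k; last by [].
  by apply: val_inj; rewrite E; case: e2 => e2; rewrite /= -e2 -e1.
- have -> : p = ddu n; last by [].
  by apply: val_inj; rewrite E; rewrite /= e1 e2.
- have -> : p = ddd n; last by [].
  by apply: val_inj; rewrite E; rewrite /= e1 e2.
Qed.

Section Structure.
Variable R : realType.
Local Notation C := (R[i]).
Local Notation Omega1 := (Omega1 R).
Local Notation Omega11 := (Omega11 R).
Local Notation Omega111 := (Omega111 R).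
Local Notation theta := (theta R).
Implicit Types (sigma : Omega11 -> Omega11) (nabla : Omega1 -> Omega11).
Implicit Types (w v : Omega1) (x y : Omega11).

Lemma Omega1_addE w v e : (w + v) e = w e + v e. Proof. by []. Qed.
Lemma Omega1_scaleE (c : C) w e : (c *: w) e = c * w e. Proof. by []. Qed.
Lemma Omega11_addE x y p : (x + y) p = x p + y p. Proof. by []. Qed.
Lemma Omega11_oppE x p : (- x) p = - x p. Proof. by []. Qed.
Lemma Omega11_scaleE (c : C) x p : (c *: x) p = c * x p. Proof. by []. Qed.
Lemma Omega111_addE (x y : Omega111) p : (x + y) p = x p + y p.
Proof. by []. Qed.
Lemma Omega111_oppE (x : Omega111) p : (- x) p = - x p. Proof. by []. Qed.
Lemma Omega111_scaleE (c : C) (x : Omega111) p : (c *: x) p = c * x p.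
Proof. by []. Qed.
Definition pointwiseE := (Omega1_addE, Omega1_scaleE, Omega11_addE,
  Omega11_oppE, Omega11_scaleE, Omega111_addE, Omega111_oppE, Omega111_scaleE).

Definition vdelta (k : nat) : nat -> C := fun l => (l == k)%:R.

(** Multiplying on both sides by the indicators of the endpoints of [p] commutes with [sigma] and
    keeps the coefficient at [p], while it makes [x] and [y] equal. *)
Lemma bimodule_map_local sigma x y p : bimodule_map sigma ->
  (forall q, src (head1 q) = src (head1 p) -> tgt (last1 q) = tgt (last1 p) ->
     x q = y q) ->
  sigma x p = sigma y p.
Proof.
move=> [_ sl sr] xy.
pose cut z := ract2 (lact2 (vdelta (src (head1 p))) z)
  (vdelta (tgt (last1 p))).
have cutE z : sigma z p = sigma (cut z) p.
  by rewrite /cut sr sl /ract2 /lact2 /vdelta !eqxx mul1r mulr1.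
rewrite (cutE x) (cutE y); congr (sigma _ p).
apply/funext => q; rewrite /cut /ract2 /lact2 /vdelta.
case: eqP => [qs|_]; last by rewrite !mul0r.
case: eqP => [qt|_]; last by rewrite !mulr0.
by rewrite xy.
Qed.

Lemma linear_zero (U V : lmodType C) (f : U -> V) : linear f -> f 0 = 0.
Proof.
by move=> fl; have := fl (-1) 0 0; rewrite !scaler0 addr0 scaleN1r addNr.
Qed.

Lemma linear_scale (U V : lmodType C) (f : U -> V) (c : C) (u : U) :
  linear f -> f (c *: u) = c *: f u.
Proof. by move=> fl; rewrite -[c *: u]addr0 fl linear_zero // addr0. Qed.

Lemma linear_sub (U V : lmodType C) (f : U -> V) (u v : U) :
  linear f -> f (u - v) = f u - f v.
Proof. by move=> fl; rewrite addrC -scaleN1r fl scaleN1r addrC. Qed.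

Lemma linear_add (U V : lmodType C) (f : U -> V) (u v : U) :
  linear f -> f (u + v) = f u + f v.
Proof. by move=> fl; have := fl 1 u v; rewrite !scale1r. Qed.

(** The calculus is inner: d f = theta f - f theta, so [theta] turns any bimodule map into a
    connection. *)
Definition inner_nabla sigma w : Omega11 := tens theta w - sigma (tens w theta).

(** Parity: an arrow moves by one vertex, a path of length 2 by zero or two. *)
Lemma arrow_not_path2 e p :
  src e = src (head1 p) -> tgt e <> tgt (last1 p).
Proof.
case: e => [n b]; elim/path2_cases: p => k; rewrite /src /tgt /=;
  by case: b; lia.
Qed.

(** Both Leibniz rules come from d f = theta f - f theta, since [sigma] commutes with the left and
    right actions. *)
Lemma inner_bimodule_connection sigma :
  bimodule_map sigma -> bimodule_connection (inner_nabla sigma) sigma.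
Proof.
move=> sb; have [sl sfl sfr] := sb; split=> // [c w v|f w|w f].
- rewrite /inner_nabla.
  have -> : tens (c *: w + v) theta = c *: tens w theta + tens v theta.
    by apply/funext => q; rewrite !pointwiseE /tens !pointwiseE mulrDl mulrA.
  rewrite sl; apply/funext => q; rewrite !pointwiseE /tens !pointwiseE; ring.
- rewrite /inner_nabla.
  have -> : tens (lact1 f w) theta = lact2 f (tens w theta).
    by apply/funext => q; rewrite /tens /lact1 /lact2 mulrA.
  rewrite sfl; apply/funext => q.
  rewrite !pointwiseE /lact2 /tens !pointwiseE /diff0 /theta /lact1.
  by rewrite -(eqP (valP q)) -/(head1 q); ring.
- rewrite /inner_nabla.
  have -> : tens w (diff0 f) =
      ract2 (tens w theta) f - tens (ract1 w f) theta.
    apply/funext => q; rewrite !pointwiseE /tens /ract1 /ract2 /diff0 /theta.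
    by rewrite (eqP (valP q)) -/(last1 q); ring.
  rewrite (linear_sub _ _ sl) sfr; apply/funext => q.
  by rewrite !pointwiseE /ract2 /tens !pointwiseE /theta /ract1; ring.
Qed.

(* The difference of the two sides is a bimodule map from [Omega1] to
   [Omega11]; it vanishes as no arrow has the endpoints of a path of length
   2. *)
Lemma bimodule_connection_inner nabla sigma :
  bimodule_connection nabla sigma -> nabla = inner_nabla sigma.
Proof.
move=> [nl sb nf nr]; have [sl _ _] := sb.
have [_ _ nf' nr'] := inner_bimodule_connection sb.
pose alpha w := nabla w - inner_nabla sigma w.
have alphal f w : alpha (lact1 f w) = lact2 f (alpha w).
  rewrite /alpha nf nf'; apply/funext => q.
  by rewrite !pointwiseE /lact2 !pointwiseE; ring.
have alphar f w : alpha (ract1 w f) = ract2 (alpha w) f.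
  rewrite /alpha nr nr'; apply/funext => q.
  by rewrite !pointwiseE /ract2 !pointwiseE; ring.
apply/funext => w; apply/funext => p; apply/eqP; rewrite -subr_eq0; apply/eqP.
rewrite -[LHS]/(alpha w p).
pose f := vdelta (src (head1 p)); pose g := vdelta (tgt (last1 p)).
have <- : alpha (ract1 (lact1 f w) g) p = alpha w p.
  by rewrite alphar alphal /ract2 /lact2 /f /g /vdelta !eqxx mul1r mulr1.
have -> : ract1 (lact1 f w) g = 0.
  apply/funext => e; rewrite /ract1 /lact1 /f /g /vdelta.
  case: eqP => [/arrow_not_path2/eqP/negbTE ->|_]; first by rewrite mulr0.
  by rewrite !mul0r.
suff -> : alpha 0 = 0 by [].
rewrite /alpha /inner_nabla (linear_zero nl).
have -> : tens 0 theta = 0 :> Omega11 by apply/funext => q; exact: mul0r.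
have -> : tens theta 0 = 0 :> Omega11 by apply/funext => q; exact: mulr0.
by rewrite (linear_zero sl) !subr0.
Qed.

Lemma wedge_relationsE x :
  wedge_relations x <-> forall n, x (ud n.+1) = x (du n).
Proof.
split=> [[b [c [e [t ->]]]] //|xE].
exists (fun n => x (uu n)), (fun n => x (dd n)), (fun n => x (du n)).
exists (x (ud 0)).
by apply: path2P => -[|n].
Qed.

(** The terms theta (x) w cancel, so the condition is that sigma (w (x) theta) + w (x) theta lies in
    the kernel of the wedge product. *)
Lemma torsion_freeE sigma : torsion_free (inner_nabla sigma) <->
  forall w n, sigma (tens w theta) (ud n.+1) + w (n.+1, true) =
              sigma (tens w theta) (du n) + w (n, false).
Proof.
have E w p : (inner_nabla sigma w - diff1 w) p =
    - (sigma (tens w theta) p + w (head1 p)).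
  by rewrite /inner_nabla /diff1 !pointwiseE /tens /theta; ring.
split=> tf w; first by move=> n; have /wedge_relationsE/(_ n) := tf w;
  rewrite !E => /oppr_inj.
by apply/wedge_relationsE => n; rewrite !E; congr (- _); exact: tf.
Qed.

(** * Torsion-free connections in coefficients *)

Section CoeffSigma.
Variables tau tau' s s' : nat -> C.
Local Notation sigma := (coeff_sigma tau tau' s s').

Lemma coeff_sigmaE x :
  ((forall n, sigma x (uu n) = s n * x (uu n))%R *
   (forall n, sigma x (dd n) = s' n.+1 * x (dd n))%R *
   (sigma x (ud 0) = tau 0%N * x (ud 0))%R *
   (forall n, sigma x (ud n.+1) =
      tau n.+1 * x (ud n.+1) + (1 + tau' n) * x (du n))%R *
   (forall n, sigma x (du n) =
      tau' n * x (du n) + (1 + tau n.+1) * x (ud n.+1))%R)%type.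
Proof. by do !apply: pair; rewrite /coeff_sigma /path_sum /= ?addr0. Qed.

Lemma coeff_sigma_bimodule : bimodule_map sigma.
Proof.
split.
- move=> c x y; apply: path2P => -[|n];
    rewrite !pointwiseE !coeff_sigmaE !pointwiseE; split; ring.
- move=> f x; apply: path2P => -[|n];
    rewrite /lact2 !coeff_sigmaE /src /=; split; ring.
- move=> x f; apply: path2P => -[|n];
    rewrite /ract2 !coeff_sigmaE /tgt /=; split; ring.
Qed.

End CoeffSigma.

Lemma path2_src_tgt_uu n p : src (head1 p) = n -> tgt (last1 p) = n.+2 ->
  p = uu n.
Proof.
by elim/path2_cases: p => m; rewrite /src /tgt /=; (lia || move=> ->).
Qed.

Lemma path2_src_tgt_dd n p : src (head1 p) = n.+2 -> tgt (last1 p) = n ->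
  p = dd n.
Proof.
by elim/path2_cases: p => m; rewrite /src /tgt /=; (lia || move=> _ ->).
Qed.

Lemma path2_loop0 p : src (head1 p) = 0%N -> tgt (last1 p) = 0%N -> p = ud 0.
Proof.
by elim/path2_cases: p => m; rewrite /src /tgt /=; (lia || move=> ->).
Qed.

Lemma path2_loopS n p : src (head1 p) = n.+1 -> tgt (last1 p) = n.+1 ->
  p = ud n.+1 \/ p = du n.
Proof.
elim/path2_cases: p => m; rewrite /src /tgt /= => e1 e2; try lia.
- by left; rewrite e1.
- by right; case: e1 => ->.
Qed.

(** By locality [sigma] is scalar where a path is determined by its endpoints, and is a 2 by 2 block
    on the two loops at each vertex but the first. Testing the torsion on a single arrow expresses
    the off-diagonal entries by the diagonal ones. *)
Lemma torsion_free_coeff_sigma sigma : bimodule_map sigma ->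
  torsion_free (inner_nabla sigma) ->
  exists tau tau' s s', sigma = coeff_sigma tau tau' s s'.
Proof.
move=> sb /torsion_freeE tf; have [sl _ _] := sb.
pose tau n : C := sigma (basis2 R (ud n)) (ud n).
pose tau' n : C := sigma (basis2 R (du n)) (du n).
have bE p q : basis2 R p q = (val q == val p)%:R by [].
(* The torsion condition only sees elements w (x) theta. Taking for w the first arrow of the loop
   [q] is enough: the other loop at that vertex starts with a different arrow. *)
have loopE n q p : q = ud n.+1 \/ q = du n ->
    src (head1 p) = n.+1 -> tgt (last1 p) = n.+1 ->
    sigma (tens (fun e => (e == head1 q)%:R) theta) p = sigma (basis2 R q) p.
  move=> qE ps pt; apply: bimodule_map_local => // r; rewrite ps pt => rs rt.
  rewrite bE /tens /theta mulr1.
  by case: qE => ->; case: (path2_loopS rs rt) => ->;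
    rewrite /= -!pair_eqE /= -!pair_eqE /= ?eqxx ?andbF.
have ud_du n : sigma (basis2 R (ud n.+1)) (du n) = 1 + tau n.+1.
  have := tf (fun e => (e == head1 (ud n.+1))%:R) n.
  rewrite !(loopE n _ _ (or_introl erefl)) // eqxx.
  by rewrite -pair_eqE /= andbF addr0 => <-; exact: addrC.
have du_ud n : sigma (basis2 R (du n)) (ud n.+1) = 1 + tau' n.
  have := tf (fun e => (e == head1 (du n))%:R) n.
  rewrite !(loopE n _ _ (or_intror erefl)) // eqxx.
  by rewrite -pair_eqE /= andbF addr0 => ->; exact: addrC.
exists tau, tau', (fun n => sigma (basis2 R (uu n)) (uu n)).
(* The shift by one matches [coeff_sigma], which uses [s' n.+1] on [dd n]. *)
exists (fun n => sigma (basis2 R (dd n.-1)) (dd n.-1)).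
have local1 x p : (forall q, src (head1 q) = src (head1 p) ->
      tgt (last1 q) = tgt (last1 p) -> q = p) ->
    sigma x p = sigma (basis2 R p) p * x p.
  move=> pu; rewrite mulrC -[RHS]/((x p *: sigma (basis2 R p)) p).
  rewrite -(linear_scale _ _ sl); apply: bimodule_map_local => // q qs qt.
  by rewrite (pu q qs qt) pointwiseE bE eqxx mulr1.
have localS x n p : src (head1 p) = n.+1 -> tgt (last1 p) = n.+1 ->
    sigma x p = x (ud n.+1) * sigma (basis2 R (ud n.+1)) p
                + x (du n) * sigma (basis2 R (du n)) p.
  move=> ps pt; set y := RHS.
  have -> : y = sigma (x (ud n.+1) *: basis2 R (ud n.+1)
                       + x (du n) *: basis2 R (du n)) p.
    by rewrite sl (linear_scale _ _ sl).
  apply: bimodule_map_local => // q; rewrite ps pt => qs qt.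
  rewrite !pointwiseE !bE; case: (path2_loopS qs qt) => ->.
  - by rewrite eqxx /= mulr1 -!pair_eqE /= -!pair_eqE /= andbF mulr0 addr0.
  - by rewrite eqxx /= mulr1 -!pair_eqE /= -!pair_eqE /= andbF mulr0 add0r.
apply/funext => x; apply: path2P => n; rewrite !coeff_sigmaE; split.
- by apply: local1 => q; exact: path2_src_tgt_uu.
- by apply: local1 => q; exact: path2_src_tgt_dd.
- case: n => [|n]; rewrite coeff_sigmaE.
    by apply: local1 => q; exact: path2_loop0.
  rewrite (@localS _ n) // du_ud -/(tau n.+1) mulrC; congr (_ + _).
  exact: mulrC.
- rewrite (@localS _ n) // ud_du -/(tau' n) addrC mulrC; congr (_ + _).
  exact: mulrC.
Qed.

Lemma coeff_sigma_torsion_free tau tau' s s' :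
  torsion_free (inner_nabla (coeff_sigma tau tau' s s')).
Proof.
apply/torsion_freeE => w n.
by rewrite !coeff_sigmaE /tens /theta /head1 /=; ring.
Qed.

(** * Extension of a connection to the tensor square *)

Lemma sliceE (e : arrow) (x : Omega111) (p : path3) (q : path2) :
  val p = (val q, e) -> slice e x q = x p. 
Proof. by move=> pE; rewrite /slice -pE (valK p). Qed.

(** The indicator accounts for the paths that do not end where the last arrow starts, at which
    [slice] is 0. *)
Lemma slice_tens21 x v (p : path3) :
  slice (val p).2 (tens21 x v) =
    v (val p).2 *: ract2 x (vdelta (src (val p).2)).
Proof.
apply/funext => q; rewrite pointwiseE /ract2 /vdelta /slice.
case: insubP => [r _ rE | /=].
  have /andP[_] := valP r; rewrite rE /= => ->.
  have qE : init2 r = q by apply: init2_of; rewrite rE.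
  by rewrite mulr1 /tens21 qE rE mulrC.
by rewrite (valP q) /= => /negbTE ->; rewrite !mulr0.
Qed.

Lemma sigma12_tens21 sigma x v : bimodule_map sigma ->
  sigma12 sigma (tens21 x v) = tens21 (sigma x) v.
Proof.
move=> [sl _ sr]; apply/funext => p; rewrite /sigma12 slice_tens21.
rewrite (linear_scale _ _ sl) sr pointwiseE /ract2 /vdelta.
have /andP[_ /eqP <-] := valP p.
by rewrite eqxx mulr1 mulrC.
Qed.

Lemma sigma12_linear sigma : linear sigma -> linear (sigma12 sigma).
Proof.
move=> sl c x y; apply/funext => p; rewrite !pointwiseE /sigma12 -pointwiseE.
rewrite -Omega11_addE -sl; congr (sigma _ _).
apply/funext => q; rewrite !pointwiseE /slice.
by case: insub => [r|]; rewrite ?pointwiseE ?mulr0 ?addr0.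
Qed.

(* The v such that e (x) v is the part of x made of the paths with first arrow
   e. *)
Definition coslice (e : arrow) (x : Omega11) : Omega1 :=
  fun f => if insub (e, f) is Some p then x p else 0.

Lemma cosliceE (e f : arrow) x (p : path2) : val p = (e, f) ->
  coslice e x f = x p.
Proof. by move=> pE; rewrite /coslice -pE (valK p). Qed.

Lemma coslice_tens w v e :
  coslice e (tens w v) = w e *: lact1 (vdelta (tgt e)) v.
Proof.
apply/funext => f; rewrite pointwiseE /lact1 /vdelta /coslice.
case: insubP => [p H pE | /= /negbTE].
  rewrite -[tens w v p]/(w (val p).1 * v (val p).2) pE /= eq_sym.
  by move: H => /= ->; rewrite mul1r.
by rewrite eq_sym => ->; rewrite mul0r mulr0.
Qed.

(* (id (x) sigma) (x (x) theta) *)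
Definition sigma23_theta sigma x : Omega111 :=
  fun p => sigma (tens (coslice (val p).1.1 x) theta) (tail2 p).

(* Expanding both copies of the inner connection, the extension to [Omega11]
   is [theta (x) x - (sigma (x) id) (id (x) sigma) (x (x) theta)]. *)
Definition inner_extension sigma x : Omega111 :=
  tens12 theta x - sigma12 sigma (sigma23_theta sigma x).

Lemma sigma23_theta_tens sigma w v : bimodule_map sigma ->
  sigma23_theta sigma (tens w v) = tens12 w (sigma (tens v theta)).
Proof.
move=> [sl sf _]; apply/funext => p; rewrite /sigma23_theta coslice_tens.
set e := (val p).1.1.
have -> : tens (w e *: lact1 (vdelta (tgt e)) v) theta =
    w e *: lact2 (vdelta (tgt e)) (tens v theta).
  apply/funext => q; rewrite !pointwiseE /tens /lact2 !pointwiseE /lact1.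
  by rewrite !mulrA.
rewrite (linear_scale _ _ sl) sf pointwiseE /lact2 /vdelta /tens12.
have /andP[/eqP e1 _] := valP p.
by rewrite -/e -[src (head1 _)]e1 eqxx mul1r.
Qed.

Lemma sigma23_theta_linear sigma : linear sigma -> linear (sigma23_theta sigma).
Proof.
move=> sl c x y; apply/funext => p; rewrite !pointwiseE /sigma23_theta.
rewrite -pointwiseE -Omega11_addE -sl; congr (sigma _ _).
apply/funext => q; rewrite !pointwiseE /tens /theta !mulr1 /coslice.
by case: insub => [r|]; rewrite ?pointwiseE ?mulr0 ?addr0.
Qed.

(** On w (x) v, the term - sigma(w (x) theta) (x) v from the first summand of the extension cancels
    against sigma(w (x) theta) (x) v from the second. *)
Lemma inner_tensor_extension sigma : bimodule_map sigma ->
  tensor_extension (inner_nabla sigma) sigma (inner_extension sigma).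
Proof.
move=> sb; have [sl _ _] := sb; split=> [c x y|w v].
  rewrite /inner_extension (sigma23_theta_linear sl) (sigma12_linear sl).
  by apply/funext => p; rewrite !pointwiseE /tens12 !pointwiseE; ring.
rewrite /inner_extension sigma23_theta_tens // /inner_nabla.
have -> : tens12 w (tens theta v - sigma (tens v theta)) =
    tens21 (tens w theta) v - tens12 w (sigma (tens v theta)).
  apply/funext => p; rewrite !pointwiseE /tens12 /tens21 !pointwiseE /tens.
  by rewrite /theta /=; ring.
rewrite (linear_sub _ _ (sigma12_linear sl)) sigma12_tens21 //.
apply/funext => p; rewrite !pointwiseE /tens12 /tens21 !pointwiseE /tens.
by rewrite /theta /=; ring.
Qed.

(** Linearity only covers finite sums, but every element, infinite combinations included, is a sum
    of two simple tensors. *)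
Lemma tensor_extension_unique nabla sigma D D' :
  tensor_extension nabla sigma D -> tensor_extension nabla sigma D' -> D = D'.
Proof.
move=> [Dl Dt] [Dl' Dt']; apply/funext => x.
have [w [v ->]] := Omega11_decomp x.
by rewrite (linear_add _ _ Dl) (linear_add _ _ Dl') !Dt !Dt'.
Qed.

Lemma inner_metric_compatible sigma g : bimodule_map sigma ->
  metric_compatible (inner_nabla sigma) sigma g <-> inner_extension sigma g = 0.
Proof.
move=> sb; have Ds := inner_tensor_extension sb.
split=> [[D [/tensor_extension_unique/(_ Ds) -> //]]|D0].
by exists (inner_extension sigma).
Qed.

Lemma tail2E n :
  ((tail2 (uuu n) = uu n.+1) * (tail2 (uud n) = ud n.+1) *
   (tail2 (udu n) = du n) * (tail2 (udd n) = dd n) *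
   (tail2 (duu n) = uu n) * (tail2 (dud n) = ud n) *
   (tail2 (ddu n) = du n) * (tail2 (ddd n) = dd n))%type.
Proof. by do !apply: pair; apply: tail2_of. Qed.

Lemma init2E n :
  ((init2 (uuu n) = uu n) * (init2 (uud n) = uu n) *
   (init2 (udu n) = ud n) * (init2 (udd n) = ud n.+1) *
   (init2 (duu n) = du n) * (init2 (dud n) = du n) *
   (init2 (ddu n) = dd n) * (init2 (ddd n) = dd n.+1))%type.
Proof. by do !apply: pair; apply: init2_of. Qed.

(** * The coefficients of the derivative of the metric *)

Section MetricCompatibility.
Variables (h phi : nat -> C) (eps : C) (tau tau' s s' : nat -> C).
Local Notation sigma := (coeff_sigma tau tau' s s').
Local Notation g := (metric h phi eps).
Local Notation Y := (sigma23_theta sigma g).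

Lemma metricE n :
  ((g (uu n) = 0%R) * (g (dd n) = 0%R) *
   (g (ud n) = h n * phi n)%R * (g (du n) = h n * eps)%R)%type.
Proof. by []. Qed.

Lemma sigma23_metricE :
  ((forall n, Y (uuu n) = 0%R) *
   (forall n, Y (uud n) = (1 + tau' n) * (h n * phi n))%R *
   (forall n, Y (udu n) = tau' n * (h n * phi n))%R *
   (forall n, Y (udd n) = s' n.+1 * (h n.+1 * phi n.+1))%R *
   (forall n, Y (duu n) = s n * (h n * eps))%R *
   (forall n, Y (dud n) = tau n * (h n * eps))%R *
   (forall n, Y (ddu n) = (1 + tau n.+1) * (h n.+1 * eps))%R *
   (forall n, Y (ddd n) = 0%R))%type.
Proof.
(do !apply: pair) => n; rewrite /sigma23_theta tail2E.
- rewrite coeff_sigmaE /tens (cosliceE _ (p := uu n)) //.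
  by rewrite metricE !mul0r mulr0.
- rewrite coeff_sigmaE /tens /theta (cosliceE _ (p := uu n)) //.
  by rewrite (cosliceE _ (p := ud n)) // !metricE; ring.
- rewrite coeff_sigmaE /tens /theta (cosliceE _ (p := ud n)) //.
  by rewrite (cosliceE _ (p := uu n)) // !metricE; ring.
- rewrite coeff_sigmaE /tens /theta (cosliceE _ (p := ud n.+1)) //.
  by rewrite !metricE; ring.
- rewrite coeff_sigmaE /tens /theta (cosliceE _ (p := du n)) //.
  by rewrite !metricE; ring.
- case: n => [|n]; rewrite coeff_sigmaE /tens /theta.
    by rewrite (cosliceE _ (p := du 0)) // !metricE; ring.
  rewrite (cosliceE _ (p := du n.+1)) // (cosliceE _ (p := dd n)) //.
  by rewrite !metricE; ring.
- rewrite coeff_sigmaE /tens /theta (cosliceE _ (p := dd n)) //.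
  by rewrite (cosliceE _ (p := du n.+1)) // !metricE; ring.
- rewrite coeff_sigmaE /tens /theta (cosliceE _ (p := dd n.+1)) //.
  by rewrite !metricE; ring.
Qed.

(* The coefficients of [nabla g = 0] at a_i a_{i+1} a'_{i+1}, at
   a_1 a'_1 a_1, at a_{i+1} a'_{i+1} a_{i+1}, at a'_i a_i a_{i+1}, at
   a'_{i+1} a'_i a_i, at a'_i a_i a'_i and at a_{i+1} a'_{i+1} a'_i. *)
Definition metric_equations : Prop :=
  [/\ forall n, h n.+1 * phi n.+1 = s n * (1 + tau' n) * (h n * phi n),
      h 0%N * eps = tau 0%N * tau' 0%N * (h 0%N * phi 0%N),
      forall n, h n.+1 * eps = tau n.+1 * tau' n.+1 * (h n.+1 * phi n.+1)
                               + (1 + tau' n) * s n * (h n * eps)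
    & [/\ forall n, tau' n * s n * (h n * eps)
                    + (1 + tau n.+1) * tau' n.+1 * (h n.+1 * phi n.+1) = 0,
          forall n, h n * eps = s' n.+1 * (1 + tau n.+1) * (h n.+1 * eps),
          forall n, h n * phi n = tau' n * tau n * (h n * eps)
                    + (1 + tau n.+1) * s' n.+1 * (h n.+1 * phi n.+1)
        & forall n, tau n.+1 * s' n.+1 * (h n.+1 * phi n.+1)
                    + (1 + tau' n) * tau n * (h n * eps) = 0]].

Lemma extension_metricE :
  let D := inner_extension sigma g in
  ((forall n, D (uuu n) = 0%R) *
   (forall n, D (uud n) =
      h n.+1 * phi n.+1 - s n * (1 + tau' n) * (h n * phi n))%R *
   (D (udu 0) = h 0%N * eps - tau 0%N * tau' 0%N * (h 0%N * phi 0%N))%R *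
   (forall n, D (udu n.+1) =
      h n.+1 * eps - (tau n.+1 * tau' n.+1 * (h n.+1 * phi n.+1)
                      + (1 + tau' n) * s n * (h n * eps)))%R *
   (forall n, D (udd n) =
      - (tau n.+1 * s' n.+1 * (h n.+1 * phi n.+1)
         + (1 + tau' n) * tau n * (h n * eps)))%R *
   (forall n, D (duu n) =
      - (tau' n * s n * (h n * eps)
         + (1 + tau n.+1) * tau' n.+1 * (h n.+1 * phi n.+1)))%R *
   (forall n, D (dud n) =
      h n * phi n - (tau' n * tau n * (h n * eps)
                     + (1 + tau n.+1) * s' n.+1 * (h n.+1 * phi n.+1)))%R *
   (forall n, D (ddu n) =
      h n * eps - s' n.+1 * (1 + tau n.+1) * (h n.+1 * eps))%R *
   (forall n, D (ddd n) = 0%R))%type.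
Proof.
move=> D.
have DE p : D p = g (tail2 p) - sigma (slice (val p).2 Y) (init2 p).
  by rewrite /D /inner_extension !pointwiseE /tens12 /theta mul1r.
(do !apply: pair); try move=> n; rewrite DE init2E coeff_sigmaE tail2E metricE.
- by rewrite (sliceE _ (p := uuu n)) // !sigma23_metricE; ring.
- by rewrite (sliceE _ (p := uud n)) // !sigma23_metricE; ring.
- by rewrite (sliceE _ (p := udu 0)) // !sigma23_metricE; ring.
(* From here on, [sigma] on the first two arrows mixes the two loops at a vertex, so each
   coefficient receives two paths with the same last arrow. *)
- rewrite (sliceE _ (p := udu n.+1)) // (sliceE _ (p := duu n)) //.
  by rewrite !sigma23_metricE; ring.
- rewrite (sliceE _ (p := udd n)) // (sliceE _ (p := dud n)) //.
  by rewrite !sigma23_metricE; ring.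
- rewrite (sliceE _ (p := duu n)) // (sliceE _ (p := udu n.+1)) //.
  by rewrite !sigma23_metricE; ring.
- rewrite (sliceE _ (p := dud n)) // (sliceE _ (p := udd n)) //.
  by rewrite !sigma23_metricE; ring.
- by rewrite (sliceE _ (p := ddu n)) // !sigma23_metricE; ring.
- by rewrite (sliceE _ (p := ddd n)) // !sigma23_metricE; ring.
Qed.

Lemma metric_compatibleE :
  metric_compatible (inner_nabla sigma) sigma g <-> metric_equations.
Proof.
rewrite inner_metric_compatible; last exact: coeff_sigma_bimodule.
have DE := extension_metricE; rewrite /= in DE.
split=> [D0|[e1 e2 e3 [e4 e5 e6 e7]]].
- have oppr0 (a : C) : - a = 0 -> a = 0 by move/eqP; rewrite oppr_eq0 => /eqP.
  split; first by move=> n; apply: subr0_eq; rewrite -DE D0.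
  + by apply: subr0_eq; rewrite -DE D0.
  + by move=> n; apply: subr0_eq; rewrite -DE D0.
  + by split=> n; [apply: oppr0|apply: subr0_eq|apply: subr0_eq|apply: oppr0];
      rewrite -DE D0.
- apply/funext; elim/path3_cases => n; try case: n => [|n];
  by rewrite DE ?e4 ?e7 ?oppr0 //; apply/eqP; rewrite subr_eq0; apply/eqP.
Qed.

End MetricCompatibility.

Lemma QLC_coeffE h phi eps nabla sigma :
  QLC (metric h phi eps) nabla sigma <-> exists tau tau' s s',
    [/\ metric_equations h phi eps tau tau' s s',
        nabla = coeff_nabla tau tau' s s' & sigma = coeff_sigma tau tau' s s'].
Proof.
split=> [[bc tf mc]|[tau [tau' [s [s' [eqs -> ->]]]]]].
- have nE := bimodule_connection_inner bc; have [_ sb _ _] := bc.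
  rewrite nE in tf mc.
  have [tau [tau' [s [s' sE]]]] := torsion_free_coeff_sigma sb tf.
  exists tau, tau', s, s'; rewrite nE sE; split=> //.
  by apply/metric_compatibleE; rewrite -sE.
- split.
  + exact/inner_bimodule_connection/coeff_sigma_bimodule.
  + exact: coeff_sigma_torsion_free.
  + exact/metric_compatibleE.
Qed.

End Structure.

(** * The equations of metric compatibility *)

Section Coefficients.
Variable R : realType.
Local Notation C := (R[i]).
Variables (h phi : nat -> C) (eps : C).
Hypotheses (h_neq0 : forall n, h n != 0) (phi_neq0 : forall n, phi n != 0).
Hypothesis eps2 : eps * eps = 1.

Let eps_neq0 : eps != 0.
Proof. by apply: contra_eq_neq eps2 => ->; rewrite mul0r eq_sym oner_neq0. Qed.

(** * Solutions of the equations are given by the recursion *)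

Section Solve.
Variables tau tau' s s' : nat -> C.
Hypothesis eqs : metric_equations h phi eps tau tau' s s'.

Lemma metric_equations_tau'_neq n : 1 + tau' n != 0.
Proof.
have [e1 _ _ _] := eqs; apply: contra_eq_neq (e1 n) => ->.
by rewrite mulr0 mul0r mulf_neq0.
Qed.

(** The equation at a_1 a'_1 a_1 starts the induction, and the one at a_{i+1} a'_{i+1} a'_i
    propagates it. *)
Lemma metric_equations_tau_neq0 n : tau n != 0.
Proof.
have [_ e2 _ [_ _ _ e7]] := eqs; elim: n => [|n tn0].
  by apply: contra_eq_neq e2 => ->; rewrite !mul0r mulf_neq0.
apply: contra_eq_neq (e7 n) => ->.
by rewrite !mul0r add0r !mulf_neq0 ?metric_equations_tau'_neq.
Qed.

(** Eliminate the product of [s' n.+1] and [1 + tau n.+1] between the equations at a'_{i+1} a'_i a_i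
    and a'_i a_i a'_i. *)
Lemma metric_equations_tau'_tau n : tau' n * tau n = eps * (phi n - phi n.+1).
Proof.
have [_ _ _ [_ e5 e6 _]] := eqs.
apply: (mulIf (mulf_neq0 (h_neq0 n) eps_neq0)).
(* The difference of the two sides is an explicit combination of the equations and of
   [eps * eps - 1]. The same device serves below. *)
apply: subr0_eq; rewrite [LHS](_ : _ = (tau' n * tau n * (h n * eps)
  + (1 + tau n.+1) * s' n.+1 * (h n.+1 * phi n.+1) - h n * phi n)
  + phi n.+1 * eps * (h n * eps - s' n.+1 * (1 + tau n.+1) * (h n.+1 * eps))
  + (eps * eps - 1) * (- h n * phi n + phi n.+1 *
     (s' n.+1 * (1 + tau n.+1) * h n.+1))); last by ring.
by rewrite -e6 -e5 eps2 !subrr mulr0 mul0r !addr0.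
Qed.

Lemma metric_equations_phi_diff n :
  phi n.+1 * (phi n.+1 - phi n.+2) = 1 - phi n.+1 / phi n.
Proof.
have [e1 _ e3 _] := eqs.
apply: (mulfI (mulf_neq0 (h_neq0 n.+1) eps_neq0)).
apply: subr0_eq; rewrite [LHS](_ : _ =
  tau n.+1 * tau' n.+1 * (h n.+1 * phi n.+1)
    + (1 + tau' n) * s n * (h n * eps) - h n.+1 * eps
  - h n.+1 * phi n.+1 * (tau' n.+1 * tau n.+1 - eps * (phi n.+1 - phi n.+2))
  - eps / phi n * (s n * (1 + tau' n) * (h n * phi n) - h n.+1 * phi n.+1)).
  by rewrite -e3 -e1 metric_equations_tau'_tau !subrr !mulr0 !subr0.
by field; rewrite phi_neq0.
Qed.

(** The previous lemma says that phi_{i+1} + 1 / phi_i does not depend on i, and the equation at a_1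
    a'_1 a_1 gives its value phi_1. *)
Lemma metric_equations_phi : phi = phi_of (phi 0%N).
Proof.
have [_ e2 _ _] := eqs.
have step n : phi n.+1 = phi 0%N - 1 / phi n.
  elim: n => [|n IHn].
    apply: (mulfI (mulf_neq0 (mulf_neq0 (h_neq0 0) (phi_neq0 0)) eps_neq0)).
    apply: subr0_eq; rewrite [LHS](_ : _ =
      h 0%N * phi 0%N * (tau' 0%N * tau 0%N - eps * (phi 0%N - phi 1%N))
      + (h 0%N * eps - tau 0%N * tau' 0%N * (h 0%N * phi 0%N))).
      by rewrite -e2 metric_equations_tau'_tau !subrr mulr0 addr0.
    by field; exact: phi_neq0.
  apply: subr0_eq; apply: (mulfI (phi_neq0 n.+1)); rewrite mulr0.
  rewrite [LHS](_ : _ = 1 - phi n.+1 / phi n - phi n.+1 * (phi n.+1 - phi n.+2)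
    + phi n.+1 * (phi n.+1 - (phi 0%N - 1 / phi n))); last first.
    by field; rewrite !phi_neq0.
  have/eqP := IHn; rewrite -subr_eq0 => /eqP ->.
  by rewrite metric_equations_phi_diff subrr mulr0 addr0.
by apply/funext; elim=> //= n IHn; rewrite step IHn.
Qed.

(** Multiply the equation at a_{i+1} a'_{i+1} a'_i by [1 + tau n.+1] and eliminate [s']. In product
    form the identity also shows that the denominator of the recursion is nonzero. *)
Lemma metric_equations_tauS n :
  (phi n + eps * tau n) * (1 + tau n.+1) = phi n.+1.
Proof.
have [_ _ _ [_ e5 _ e7]] := eqs.
apply: (mulfI (h_neq0 n)); apply: subr0_eq.
rewrite [LHS](_ : _ = (tau n.+1 * s' n.+1 * (h n.+1 * phi n.+1)
    + (1 + tau' n) * tau n * (h n * eps)) * (1 + tau n.+1)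
  + eps * phi n.+1 * tau n.+1 *
    (h n * eps - s' n.+1 * (1 + tau n.+1) * (h n.+1 * eps))
  + (eps * eps - 1) * phi n.+1 * tau n.+1 *
    (s' n.+1 * (1 + tau n.+1) * h n.+1 - h n)
  - h n * eps * (1 + tau n.+1) * (tau' n * tau n - eps * (phi n - phi n.+1))
  - h n * (1 + tau n.+1) * (phi n - phi n.+1) * (eps * eps - 1)).
  rewrite e7 -e5 eps2 metric_equations_tau'_tau !subrr.
  by rewrite !(mulr0, mul0r) !addr0 !subr0.
ring.
Qed.

Lemma metric_equations_den_neq0 n : phi n + eps * tau n != 0.
Proof.
by have := phi_neq0 n.+1; rewrite -metric_equations_tauS mulf_eq0 => /norP[].
Qed.

Lemma metric_equations_tau : tau = tau_of eps phi (tau 0%N).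
Proof.
apply/funext; elim=> //= n <-.
by rewrite -metric_equations_tauS; field; exact: metric_equations_den_neq0.
Qed.

Lemma metric_equations_tau' : tau' = tau'_of eps phi tau.
Proof.
apply/funext => n; rewrite /tau'_of mulrA -metric_equations_tau'_tau mulfK //.
exact: metric_equations_tau_neq0.
Qed.

Lemma metric_equations_sigma : s = sigma_of h eps phi tau.
Proof.
have [e1 _ _ _] := eqs; apply/funext => n.
rewrite /sigma_of -metric_equations_tau' e1.
by field; rewrite h_neq0 phi_neq0 metric_equations_tau'_neq.
Qed.

(** The equations leave [s' 0] free, hence the restriction to successors. *)
Lemma metric_equations_sigma' n : s' n.+1 = sigma'_of h eps phi tau n.+1.
Proof.
have [_ _ _ [_ e5 _ _]] := eqs.
have h1 : h n = s' n.+1 * (1 + tau n.+1) * h n.+1.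
  by apply: (mulIf eps_neq0); rewrite e5 mulrA.
rewrite /sigma'_of /= h1 -metric_equations_tauS.
field; rewrite h_neq0 metric_equations_den_neq0 /=.
have := phi_neq0 n.+1.
by rewrite -metric_equations_tauS mulf_eq0 => /norP[_ ->].
Qed.

Lemma metric_equations_well_defined : well_defined eps phi tau.
Proof.
move=> n; split; first exact: metric_equations_tau_neq0.
- exact: metric_equations_den_neq0.
- by rewrite -metric_equations_tau'; exact: metric_equations_tau'_neq.
Qed.

End Solve.

(** * The recursion solves the equations *)

Section Family.
Variable tau1 : C.
Local Notation tau := (tau_of eps phi tau1).
Local Notation tau' := (tau'_of eps phi tau).
Hypothesis phi_rec : phi = phi_of (phi 0%N).
Hypothesis wd : well_defined eps phi tau.

Lemma phi_recS n : phi n.+1 = phi 0%N - 1 / phi n.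
Proof. by rewrite {1 3}phi_rec. Qed.

Lemma phi_diffS n :
  phi n.+1 * (phi n.+1 - phi n.+2) = 1 - phi n.+1 / phi n.
Proof. by rewrite [phi n.+2]phi_recS {2}phi_recS; field; rewrite !phi_neq0. Qed.

Lemma tau_ofS n : 1 + tau n.+1 = phi n.+1 / (phi n + eps * tau n).
Proof. by rewrite /= addrA subrr add0r. Qed.

Lemma family_metric_equations :
  metric_equations h phi eps tau tau' (sigma_of h eps phi tau)
    (sigma'_of h eps phi tau).
Proof.
have tau0 n : tau n != 0 by case: (wd n).
have den0 n : phi n + eps * tau n != 0 by case: (wd n).
have tau'0 n : 1 + tau' n != 0 by case: (wd n).
have tt' n : tau' n * tau n = eps * (phi n - phi n.+1).
  by rewrite /tau'_of; field; exact: tau0.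
have e1 n : sigma_of h eps phi tau n * (1 + tau' n) =
    h n.+1 * phi n.+1 / (h n * phi n).
  by rewrite /sigma_of; field; rewrite h_neq0 phi_neq0 tau'0.
have e5 n : sigma'_of h eps phi tau n.+1 * (1 + tau n.+1) = h n / h n.+1.
  by rewrite tau_ofS /sigma'_of /=; field; rewrite !h_neq0 phi_neq0 den0.
(* Both sides equal eps (phi_i - phi_{i+1}) + tau_i. *)
have t1 n : (1 + tau' n) * tau n =
    - eps * tau n.+1 * (phi n + eps * tau n).
  rewrite mulrDl mul1r tt' /= [RHS](_ : _ = eps * (phi n - phi n.+1)
    + eps * eps * tau n); last by field; exact: den0.
  by rewrite eps2 mul1r addrC.
split=> [n||n|].
- by rewrite e1 divfK // mulf_neq0.
- rewrite [_ * tau' _]mulrC tt' phi_recS.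
  rewrite [RHS](_ : _ = eps * h 0%N); first exact: mulrC.
  by field; exact: phi_neq0.
- rewrite [(1 + _) * _]mulrC e1 [_ * tau' _]mulrC tt'.
  rewrite [RHS](_ : _ = eps * h n.+1 * (phi n.+1 * (phi n.+1 - phi n.+2))
    + h n.+1 * phi n.+1 / phi n * eps); last by field; rewrite h_neq0 phi_neq0.
  by rewrite phi_diffS; field; exact: phi_neq0.
- split=> n.
  (* Rewriting 1 + tau'_i by [t1] and removing phi_{i+2} by [phi_diffS] gives the two terms a common
     denominator. They then cancel with tau_i and tau_{i+1} treated as independent variables. *)
  + have s_n : sigma_of h eps phi tau n = h n.+1 * phi n.+1 * tau n /
        (h n * phi n * (- eps * tau n.+1 * (phi n + eps * tau n))).
      by rewrite -t1 /sigma_of; field; rewrite h_neq0 phi_neq0 tau'0 tau0.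
    have tau'n : tau' n = eps * (phi n - phi n.+1) / tau n.
      by rewrite -tt' mulfK.
    have tau'n1 : tau' n.+1 = eps * (1 - phi n.+1 / phi n) /
        (phi n.+1 * tau n.+1).
      by rewrite -phi_diffS mulrCA -tt'; field; rewrite phi_neq0 tau0.
    rewrite s_n tau'n tau'n1 tau_ofS.
    move: (tau n.+1) (tau0 n.+1) (tau n) (tau0 n) (den0 n) => T T0 t t0 d0.
    by field; rewrite h_neq0 !phi_neq0 T0 t0 d0 eps_neq0.
  + by rewrite e5; field; exact: h_neq0.
  + rewrite tt' [(1 + _) * _]mulrC e5.
    rewrite [RHS](_ : _ = eps * eps * (phi n - phi n.+1) * h n +
      h n * phi n.+1); last by field; exact: h_neq0.
    by rewrite eps2; ring.
  + rewrite t1 /sigma'_of [n.+1.-1]/=.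
    rewrite [LHS](_ : _ = tau n.+1 * (phi n + eps * tau n) * h n *
      (1 - eps * eps)); last by field; rewrite h_neq0 phi_neq0.
    by rewrite eps2 subrr mulr0.
Qed.

(** * Consequences of a unimodular first coefficient *)

Section Star.
Hypotheses (h_real : forall n, h n \is Num.real).
Hypothesis phi0_real : phi 0%N \is Num.real.
Hypothesis eps_real : eps \is Num.real.

Lemma phi_real n : phi n \is Num.real.
Proof.
elim: n => [//|n IHn]; rewrite phi_recS.
by rewrite rpredB // rpredM // ?rpred1 // rpredV.
Qed.

Let conj_h n : Num.conj (h n) = h n. Proof. exact: conj_Creal. Qed.
Let conj_phi n : Num.conj (phi n) = phi n.
Proof. exact/conj_Creal/phi_real. Qed.
Let conj_eps : Num.conj eps = eps. Proof. exact: conj_Creal. Qed.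

Let conjE := (rmorphD, rmorphB, rmorphN, rmorphM, rmorph1, fmorphV).

(** At the first vertex the right-hand side is 1 by the recursion for phi. In the induction step,
    the discrepancy at [n.+1] is a multiple of the one at [n]. *)
Lemma tau_mul_conj n : tau1 * Num.conj tau1 = 1 ->
  tau n * Num.conj (tau n) = phi n * (phi n - phi n.+1).
Proof.
move=> tau1_norm; elim: n => [|n IHn].
  by rewrite phi_recS /= tau1_norm; field; exact: phi_neq0.
have [t0 d0 _] := wd n.
have dc0 : phi n + eps * Num.conj (tau n) != 0.
  have : Num.conj (phi n + eps * tau n) != 0 by rewrite fmorph_eq0.
  by rewrite rmorphD rmorphM /= conj_phi conj_eps.
rewrite phi_diffS /= !conjE /= !conj_phi conj_eps.
move: (tau n) (Num.conj (tau n)) t0 d0 dc0 IHn => t tc t0 d0 dc0 IHn.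
apply: subr0_eq; rewrite [LHS](_ : _ =
  (phi n.+1 / phi n) / ((phi n + eps * t) * (phi n + eps * tc)) *
  (eps * eps * t * tc - phi n * (phi n - phi n.+1))); last first.
  by field; rewrite phi_neq0 d0 dc0.
by rewrite eps2 mul1r IHn subrr mulr0.
Qed.

(** This is the previous lemma in terms of the denominator D. *)
Lemma den_mul_conj n : tau1 * Num.conj tau1 = 1 ->
  let D := phi n + eps * tau n in
  D * Num.conj D = phi n * (D + Num.conj D - phi n.+1).
Proof.
move=> /(tau_mul_conj n) tc /=; rewrite !conjE /= conj_phi conj_eps.
apply: subr0_eq; rewrite [LHS](_ : _ =
  eps * eps * (tau n * Num.conj (tau n)) - phi n * (phi n - phi n.+1));
  last by ring.
by rewrite eps2 mul1r tc subrr.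
Qed.

Lemma conj_tau' n : tau1 * Num.conj tau1 = 1 ->
  Num.conj (tau' n) = eps * tau n / phi n.
Proof.
move=> /(tau_mul_conj n) tc; have [t0 _ _] := wd n.
have tc0 : Num.conj (tau n) != 0 by rewrite fmorph_eq0.
rewrite /tau'_of !conjE /= !conj_phi conj_eps -[_ - _](mulKf (phi_neq0 n)) -tc.
by field; rewrite phi_neq0 tc0.
Qed.

Lemma tau'_conj n : tau1 * Num.conj tau1 = 1 ->
  tau' n = eps * Num.conj (tau n) / phi n.
Proof.
move=> tau1_norm; apply: (fmorph_inj (Num.conj : {rmorphism C -> C})) => /=.
by rewrite conj_tau' // !conjE /= conj_phi conj_eps conjCK.
Qed.

(** With D the denominator of the recursion, tau_{i+1} = phi_{i+1} / D - 1 and tau'_i = conj D /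
    phi_i - 1. The first equation is then a direct cancellation, and each of the others is a
    multiple of [den_mul_conj]. *)
Lemma star_equations : tau1 * Num.conj tau1 = 1 ->
  let s := sigma_of h eps phi tau in let s' := sigma'_of h eps phi tau in
  [/\ forall n, s n * Num.conj (s' n.+1) = 1,
      forall n, tau n.+1 * Num.conj (tau n.+1)
                + (1 + tau' n) * (1 + Num.conj (tau n.+1)) = 1,
      forall n, tau n.+1 * (1 + Num.conj (tau' n))
                + (1 + tau' n) * Num.conj (tau' n) = 0,
      forall n, (1 + tau n.+1) * Num.conj (tau n.+1)
                + tau' n * (1 + Num.conj (tau n.+1)) = 0
    & forall n, (1 + tau n.+1) * (1 + Num.conj (tau' n))
                + tau' n * Num.conj (tau' n) = 1].
Proof.
move=> tau1_norm s s'; rewrite /s /s'.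
have D0 n : phi n + eps * tau n != 0 by case: (wd n).
have Dc0 n : Num.conj (phi n + eps * tau n) != 0 by rewrite fmorph_eq0.
have tauD n : tau n.+1 = phi n.+1 / (phi n + eps * tau n) - 1.
  by rewrite /= addrC.
have tauDc n : Num.conj (tau n.+1) =
    phi n.+1 / Num.conj (phi n + eps * tau n) - 1.
  by rewrite tauD !conjE /= !conj_phi.
have tau'D n : tau' n = Num.conj (phi n + eps * tau n) / phi n - 1.
  rewrite tau'_conj // rmorphD rmorphM /= conj_phi conj_eps.
  by field; exact: phi_neq0.
have tau'Dc n : Num.conj (tau' n) = (phi n + eps * tau n) / phi n - 1.
  by rewrite conj_tau' //; field; exact: phi_neq0.
have key n := den_mul_conj n tau1_norm; rewrite /= in key.
have key0 n : (phi n + eps * tau n) * Num.conj (phi n + eps * tau n)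
    - phi n * (phi n + eps * tau n + Num.conj (phi n + eps * tau n) - phi n.+1)
    = 0 by rewrite key subrr.
split=> n.
- have -> : Num.conj (sigma'_of h eps phi tau n.+1) =
      h n * Num.conj (phi n + eps * tau n) / (h n.+1 * phi n.+1).
    rewrite /sigma'_of [n.+1.-1]/= rmorphM fmorphV rmorphM.
    by rewrite [X in _ / X]rmorphM /= !conj_h !conj_phi.
  rewrite /sigma_of tau'D [1 + (_ - 1)]addrC subrK.
  move: (Dc0 n); move: (Num.conj _) => Dc Dc_neq0.
  by field; rewrite !h_neq0 !phi_neq0 Dc_neq0.
- rewrite tauDc tauD tau'D; move: (key0 n) (D0 n) (Dc0 n).
  move: (phi n + _) (Num.conj _) => D Dc kD D_neq0 Dc_neq0.
  apply: subr0_eq; rewrite [LHS](_ : _ = phi n.+1 / (phi n * D * Dc) *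
    (D * Dc - phi n * (D + Dc - phi n.+1))); first by rewrite kD mulr0.
  by field; rewrite phi_neq0 D_neq0 Dc_neq0.
- rewrite tau'Dc tauD tau'D; move: (key0 n) (D0 n) (Dc0 n).
  move: (phi n + _) (Num.conj _) => D Dc kD D_neq0 Dc_neq0.
  rewrite [LHS](_ : _ = (phi n * phi n)^-1 *
    (D * Dc - phi n * (D + Dc - phi n.+1))); first by rewrite kD mulr0.
  by field; rewrite phi_neq0 D_neq0.
- rewrite tauDc tauD tau'D; move: (key0 n) (D0 n) (Dc0 n).
  move: (phi n + _) (Num.conj _) => D Dc kD D_neq0 Dc_neq0.
  rewrite [LHS](_ : _ = phi n.+1 / (phi n * D * Dc) *
    (D * Dc - phi n * (D + Dc - phi n.+1))); first by rewrite kD mulr0.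
  by field; rewrite phi_neq0 D_neq0 Dc_neq0.
- rewrite tau'Dc tauD tau'D; move: (key0 n) (D0 n) (Dc0 n).
  move: (phi n + _) (Num.conj _) => D Dc kD D_neq0 Dc_neq0.
  apply: subr0_eq; rewrite [LHS](_ : _ = (phi n * phi n)^-1 *
    (D * Dc - phi n * (D + Dc - phi n.+1))); first by rewrite kD mulr0.
  by field; rewrite phi_neq0 D_neq0.
Qed.

End Star.
End Family.

End Coefficients.

(** * The star structure *)

Section StarPreserving.
Variable R : realType.
Local Notation C := (R[i]).
Variables tau tau' s s' : nat -> C.
Local Notation nabla := (coeff_nabla tau tau' s s').
Local Notation sigma := (coeff_sigma tau tau' s s').

Lemma coeff_nablaE w p :
  nabla w p = w (last1 p) - sigma (tens w (theta R)) p.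
Proof. by rewrite /coeff_nabla !pointwiseE /tens mul1r. Qed.

Lemma daggerE (x : Omega11 R) n :
  ((dagger x (uu n) = Num.conj (x (dd n))) *
   (dagger x (dd n) = Num.conj (x (uu n))) *
   (dagger x (ud n) = Num.conj (x (ud n))) *
   (dagger x (du n) = Num.conj (x (du n))))%type.
Proof.
by (do !apply: pair); rewrite /dagger; congr (Num.conj (x _)); apply: val_inj.
Qed.

(** Test on [theta], for which theta^* = - theta, at a_1 (x) a'_1, the only loop at its vertex. *)
Lemma star_preserving_tau0 : star_preserving nabla sigma ->
  tau 0%N * Num.conj (tau 0%N) = 1.
Proof.
move=> /(_ (theta R)) /(congr1 (fun x : Omega11 R => x (ud 0))).
rewrite coeff_nablaE !coeff_sigmaE daggerE coeff_nablaE coeff_sigmaE.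
have starE e : star (theta R) e = -1 :> C.
  by rewrite /star -[theta R _]/(1 : C) conjC1.
rewrite /tens !starE -![theta R _]/(1 : C) !mulr1 rmorphB rmorph1 /= => e.
by apply: subr0_eq; rewrite [LHS](_ : _ = -1 - tau 0%N * -1 -
  tau 0%N * (1 - Num.conj (tau 0%N))); [rewrite e subrr | ring].
Qed.

(** As theta^* = - theta, the claim reduces to sigma dagger sigma = dagger on w (x) theta. Since
    [dagger] exchanges [uu n] with [dd n] and fixes the loops, the hypotheses say this block by
    block: M conj(M) = 1 for the 2 by 2 block M on [ud n.+1] and [du n]. *)
Lemma coeff_star_preserving :
  tau 0%N * Num.conj (tau 0%N) = 1 ->
  (forall n, s n * Num.conj (s' n.+1) = 1) ->
  (forall n, tau n.+1 * Num.conj (tau n.+1)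
             + (1 + tau' n) * (1 + Num.conj (tau n.+1)) = 1) ->
  (forall n, tau n.+1 * (1 + Num.conj (tau' n))
             + (1 + tau' n) * Num.conj (tau' n) = 0) ->
  (forall n, (1 + tau n.+1) * Num.conj (tau n.+1)
             + tau' n * (1 + Num.conj (tau n.+1)) = 0) ->
  (forall n, (1 + tau n.+1) * (1 + Num.conj (tau' n))
             + tau' n * Num.conj (tau' n) = 1) ->
  star_preserving nabla sigma.
Proof.
move=> e0 es e1 e2 e3 e4 w.
have es' n : s' n.+1 * Num.conj (s n) = 1.
  by rewrite -[s' _]conjCK -rmorphM mulrC es rmorph1.
have conjB p : Num.conj (nabla w p) = Num.conj (w (last1 p)) -
    Num.conj (sigma (tens w (theta R)) p).
  by rewrite coeff_nablaE rmorphB.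
have tensE v p : tens v (theta R) p = v (head1 p) by rewrite /tens mulr1.
have starE e : star w e = - Num.conj (w (rev_arrow e)) by [].
apply: path2P => n; split.
- rewrite coeff_nablaE !coeff_sigmaE daggerE conjB coeff_sigmaE !tensE !starE.
  rewrite rmorphM /head1 /last1 /rev_arrow /=.
  rewrite [RHS](_ : _ = s n * Num.conj (w (n, false))
    - s n * Num.conj (s' n.+1) * Num.conj (w (n.+1, false))); last by ring.
  by rewrite es; ring.
- rewrite coeff_nablaE !coeff_sigmaE daggerE conjB coeff_sigmaE !tensE !starE.
  rewrite rmorphM /head1 /last1 /rev_arrow /=.
  rewrite [RHS](_ : _ = s' n.+1 * Num.conj (w (n.+1, true))
    - s' n.+1 * Num.conj (s n) * Num.conj (w (n, true))); last by ring.
  by rewrite es'; ring.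
- case: n => [|n]; rewrite coeff_nablaE !coeff_sigmaE !daggerE !conjB;
    rewrite !coeff_sigmaE !tensE !starE.
  + rewrite rmorphM /head1 /last1 /rev_arrow /=.
    rewrite [RHS](_ : _ = tau 0%N * Num.conj (w (0%N, false))
      - tau 0%N * Num.conj (tau 0%N) * Num.conj (w (0%N, true))); last by ring.
    by rewrite e0; ring.
  + rewrite !rmorphD !rmorphM !rmorphD !rmorph1 /head1 /last1 /rev_arrow /=.
    rewrite [RHS](_ : _ = tau n.+1 * Num.conj (w (n.+1, false))
      + (1 + tau' n) * Num.conj (w (n, true))
      - (tau n.+1 * Num.conj (tau n.+1)
         + (1 + tau' n) * (1 + Num.conj (tau n.+1))) * Num.conj (w (n.+1, true))
      - (tau n.+1 * (1 + Num.conj (tau' n)) + (1 + tau' n) * Num.conj (tau' n))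
        * Num.conj (w (n, false))); last by ring.
    by rewrite e1 e2; ring.
- rewrite coeff_nablaE !coeff_sigmaE !daggerE !conjB.
  rewrite !coeff_sigmaE !tensE !starE.
  rewrite !rmorphD !rmorphM !rmorphD !rmorph1 /head1 /last1 /rev_arrow /=.
  rewrite [RHS](_ : _ = tau' n * Num.conj (w (n, true))
    + (1 + tau n.+1) * Num.conj (w (n.+1, false))
    - ((1 + tau n.+1) * Num.conj (tau n.+1)
       + tau' n * (1 + Num.conj (tau n.+1))) * Num.conj (w (n.+1, true))
    - ((1 + tau n.+1) * (1 + Num.conj (tau' n)) + tau' n * Num.conj (tau' n))
      * Num.conj (w (n, false))); last by ring.
  by rewrite e3 e4; ring.
Qed.

End StarPreserving.

(** * Exceptional parameters *)

Section Countability.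
Variable R : realType.
Local Notation C := (R[i]).

Lemma countable_setU T (A B : set T) :
  countable A -> countable B -> countable (A `|` B).
Proof.
move=> cA cB; rewrite -bigcup2E; apply: bigcup_countable => [|n _].
  exact: countableP.
by rewrite /bigcup2; case: ifP => // _; case: ifP.
Qed.

(** Otherwise the real interval [0, 1], embedded in C, would be countable and have Lebesgue measure
    0. This supplies an admissible tau_1 in the existence of QLCs. *)
Lemma exists_notin_countable (A : set C) : countable A ->
  exists z : C, z != 0 /\ ~ A z.
Proof.
move=> cA; apply: contrapT => H.
pose B : set C := 0 |` A.
have cB : countable B by apply: countable_setU => //; exact: countable1.
have BT z : B z.
  apply: contrapT => Bz; apply: H; exists z.
  split; last by move=> Az; apply: Bz; right.
  by apply/eqP => z0; apply: Bz; left.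
have : countable ([set` `[0, 1]] : set R).
  have /countable_injP[f finj] := cB.
  apply/countable_injP; exists (f \o (fun x : R => (x%:C)%C)) => x y _ _ /= fxy.
  by have [] := finj _ _ (mem_set (BT _)) (mem_set (BT _)) fxy.
move=> /lebesgue_measure.countable_lebesgue_measure0.
rewrite lebesgue_measure.lebesgue_measure_itv /=.
rewrite constructive_ereal.lte_fin ltr01.
by move=> [] /eqP; rewrite subr0 oner_eq0.
Qed.

Lemma countable_roots (p : {poly C}) : p != 0 ->
  countable [set x | root p x].
Proof.
move=> p0; have [r pE] := closed_field_poly_normal p.
apply: (sub_countable _ (finite_set_countable (finite_seq r))).
apply: subset_card_le => x /=; rewrite {1}pE rootZ ?lead_coef_eq0 //.
by rewrite root_prod_XsubC.
Qed.

Lemma countable_subsingleton T (A : set T) :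
  (forall x y, A x -> A y -> x = y) -> countable A.
Proof.
move=> A1; apply/countable_injP; exists (fun=> 0%N) => x y.
by move=> /set_mem Ax /set_mem Ay _; exact: A1.
Qed.

(** These are the Chebyshev polynomials of the second kind, evaluated at X / 2. *)
Fixpoint phi_poly (n : nat) : {poly C} :=
  match n with
  | 0 => 1
  | m.+1 => if m is k.+1 then 'X * phi_poly m - phi_poly k else 'X
  end.

Lemma size_phi_poly n : size (phi_poly n) = n.+1.
Proof.
suff: size (phi_poly n) = n.+1 /\ size (phi_poly n.+1) = n.+2 by case.
elim: n => [|n [IH1 IH2]]; first by rewrite /= size_poly1 size_polyX.
split=> //.
have -> : phi_poly n.+2 = 'X * phi_poly n.+1 - phi_poly n by [].
have sX : size ('X * phi_poly n.+1) = n.+3.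
  by rewrite mulrC size_mulX ?IH2 // -size_poly_eq0 IH2.
by rewrite size_polyDl ?size_polyN ?IH1 sX.
Qed.

Lemma phi_of_poly x : (forall n, ~~ root (phi_poly n) x) ->
  forall n, phi_of x n = (phi_poly n.+1).[x] / (phi_poly n).[x].
Proof.
move=> nr; elim=> [|n IHn]; first by rewrite /= hornerX hornerC divr1.
have := nr n.+1; have := nr n; rewrite /root => n0 n1.
rewrite [LHS]/= IHn.
have -> : phi_poly n.+2 = 'X * phi_poly n.+1 - phi_poly n by [].
rewrite hornerD hornerN hornerM hornerX.
by field; rewrite n0 n1.
Qed.

Lemma countable_phi_of_vanishing :
  countable [set phi1 : C | phi1 != 0 /\ ~ (forall n, phi_of phi1 n != 0)].
Proof.
apply: (@sub_countable _ _ _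
  (\bigcup_n [set x | root (phi_poly n) x])); last first.
  apply: bigcup_countable => [|n _]; first exact: countableP.
  by apply: countable_roots; rewrite -size_poly_eq0 size_phi_poly.
apply: subset_card_le => x /= [_ xn]; apply: contrapT => nr; apply: xn => n.
have nr' m : ~~ root (phi_poly m) x by apply/negP => rm; apply: nr; exists m.
by rewrite phi_of_poly // mulf_neq0 ?invr_neq0 // -/(root _ _).
Qed.

Variables (phi : nat -> C) (eps : C).
Hypothesis phi_neq0 : forall n, phi n != 0.
Hypothesis eps2 : eps * eps = 1.

Let eps_neq0 : eps != 0.
Proof. by apply: contra_eq_neq eps2 => ->; rewrite mul0r eq_sym oner_neq0. Qed.

Local Notation tau := (tau_of eps phi).
Local Notation den t n := (phi n + eps * tau t n).

(** Each step of the recursion is a Möbius map of determinant - eps phi_{i+1}, hence injective. *)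
Lemma tau_of_inj t u n :
  (forall k, (k < n)%N -> den t k != 0) ->
  (forall k, (k < n)%N -> den u k != 0) -> tau t n = tau u n -> t = u.
Proof.
elim: n => [//|n IHn] dt du /= /addrI /(mulfI (phi_neq0 _)) /invr_inj /addrI.
move=> /(mulfI eps_neq0).
by apply: IHn => k kn; [apply: dt|apply: du]; apply: ltnW.
Qed.

(** The third denominator satisfies (1 + tau'_i) tau_i = - eps tau_{i+1} (phi_i + eps tau_i), a
    product of nonzero factors. *)
Lemma well_defined_tau t : (forall n, tau t n != 0) ->
  (forall n, den t n != 0) -> well_defined eps phi (tau t).
Proof.
move=> t0 d0 n; split => //.
have : (1 + tau'_of eps phi (tau t) n) * tau t n =
    - eps * tau t n.+1 * den t n.
  rewrite /tau'_of /= [RHS](_ : _ = eps * (phi n - phi n.+1)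
    + eps * eps * tau t n); last by field; exact: d0.
  by rewrite eps2; field; exact: t0.
move=> e; apply/eqP => e0; move: e; rewrite e0 mul0r => /esym/eqP.
rewrite !mulf_eq0 oppr_eq0 (negbTE eps_neq0) (negbTE (t0 n.+1)).
by rewrite (negbTE (d0 n)).
Qed.

(** A failure means that some tau_n is 0 or - eps phi_n while all earlier denominators are nonzero.
    By injectivity each such condition holds for at most one tau_1. *)
Lemma countable_tau_of_ill_defined :
  countable [set t : C | t != 0 /\ ~ well_defined eps phi (tau t)].
Proof.
pose level n v : set C :=
  [set t | (forall k, (k < n)%N -> den t k != 0) /\ tau t n = v].
apply: (@sub_countable _ _ _
  (\bigcup_n (level n 0 `|` level n (- eps * phi n)))); last first.
  apply: bigcup_countable => [|n _]; first exact: countableP.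
  by apply: countable_setU; apply: countable_subsingleton =>
    t u [dt tv] [du uv];
    apply: (tau_of_inj dt du); rewrite tv uv.
apply: subset_card_le => t /= [_ ill]; apply: contrapT => nl; apply: ill.
(* Strong induction: the first vanishing denominator would put [t] in a level set. *)
have d0 n : den t n != 0.
  have [m] := ubnP n; elim: m n => // m IHm n; rewrite ltnS => nm.
  apply/eqP => dn; apply: nl; exists n => //; right; split.
    by move=> k kn; apply: IHm; apply: leq_trans nm.
  by rewrite -[tau t n]mul1r -eps2 -mulrA -(addr0_eq dn) mulNr mulrN.
apply: well_defined_tau => // n; apply/eqP => tn; apply: nl; exists n => //.
by left; split.
Qed.

End Countability.

Theorem proposition4p2 (R : realType) (h : nat -> R[i]) (eps : R[i])
    (h_neq0 : forall n, h n != 0) (eps_sign : eps = 1 \/ eps = -1) :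
  (* the allowed direction coefficients are those given by the recursion *)
  [/\ forall phi : nat -> R[i], (forall n, phi n != 0) ->
        (exists nabla sigma, QLC (metric h phi eps) nabla sigma) <->
        phi = phi_of (phi 0%N),
      (* they are a 1-parameter family, with parameter phi_1 *)
      countable [set phi1 : R[i] |
        phi1 != 0 /\ ~ (forall n, phi_of phi1 n != 0)],
      (* the QLCs are exactly those of the given family *)
      forall phi : nat -> R[i], (forall n, phi n != 0) ->
        phi = phi_of (phi 0%N) ->
        forall nabla sigma,
          QLC (metric h phi eps) nabla sigma <->
          exists tau1 : R[i],
            [/\ tau1 != 0, well_defined eps phi (tau_of eps phi tau1),
                nabla = family_nabla h eps phi tau1
              & sigma = family_sigma h eps phi tau1],
      (* it is a 1-parameter family, with parameter tau_1 *)
      forall phi : nat -> R[i], (forall n, phi n != 0) ->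
        phi = phi_of (phi 0%N) ->
        countable [set tau1 : R[i] |
          tau1 != 0 /\ ~ well_defined eps phi (tau_of eps phi tau1)]
    & forall (phi : nat -> R[i]) (tau1 : R[i]), (forall n, phi n != 0) ->
        phi = phi_of (phi 0%N) ->
        tau1 != 0 -> well_defined eps phi (tau_of eps phi tau1) ->
        (forall n, h n \is Num.real) -> phi 0%N \is Num.real ->
        star_preserving (family_nabla h eps phi tau1)
                        (family_sigma h eps phi tau1) <-> `|tau1| = 1].
Proof.
have eps2 : eps * eps = 1 by case: eps_sign => ->; rewrite ?mulrNN mulr1.
have eps_real : eps \is Num.real.
  by case: eps_sign => ->; rewrite ?rpredN rpred1.
have qlcE phi (phi_neq0 : forall n, phi n != 0) :
    phi = phi_of (phi 0%N) -> forall nabla sigma,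
    QLC (metric h phi eps) nabla sigma <->
    exists tau1 : R[i],
      [/\ tau1 != 0, well_defined eps phi (tau_of eps phi tau1),
          nabla = family_nabla h eps phi tau1
        & sigma = family_sigma h eps phi tau1].
  move=> phi_rec nabla sigma; rewrite QLC_coeffE; split.
  - move=> [tau [tau' [s [s' [eqs -> ->]]]]].
    have tauE := metric_equations_tau h_neq0 phi_neq0 eps2 eqs.
    have tau'E := metric_equations_tau' h_neq0 phi_neq0 eps2 eqs.
    have sE := metric_equations_sigma h_neq0 phi_neq0 eps2 eqs.
    have s'E := metric_equations_sigma' h_neq0 phi_neq0 eps2 eqs.
    have wd := metric_equations_well_defined h_neq0 phi_neq0 eps2 eqs.
    have sigmaE : coeff_sigma tau tau' s s' = family_sigma h eps phi (tau 0%N).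
      rewrite /family_sigma -tauE -tau'E -sE; apply/funext => x.
      (* [s'E] only covers successors, which suffices as [coeff_sigma] never reads [s' 0]. *)
      by apply: path2P => -[|n]; rewrite !coeff_sigmaE s'E.
    exists (tau 0%N); split; first by case: (wd 0%N).
    + by rewrite -tauE.
    + by rewrite /coeff_nabla sigmaE.
    + exact: sigmaE.
  - move=> [tau1 [_ wd -> ->]].
    exists (tau_of eps phi tau1), (tau'_of eps phi (tau_of eps phi tau1)).
    exists (sigma_of h eps phi (tau_of eps phi tau1)).
    exists (sigma'_of h eps phi (tau_of eps phi tau1)); split=> //.
    exact: family_metric_equations.
split.
- move=> phi phi_neq0; split.
    move=> [nabla [sigma /QLC_coeffE [tau [tau' [s [s' [eqs _ _]]]]]]].
    exact: metric_equations_phi eqs.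
  move=> phi_rec.
  (* Any tau_1 outside the countable exceptional set yields a QLC. *)
  have [t [t0 twd]] :=
    exists_notin_countable (countable_tau_of_ill_defined phi_neq0 eps2).
  exists (family_nabla h eps phi t), (family_sigma h eps phi t).
  apply/qlcE => //; exists t; split=> //.
  by apply: contrapT => wd; apply: twd.
- exact: countable_phi_of_vanishing.
- exact: qlcE.
- by move=> phi phi_neq0 _; exact: countable_tau_of_ill_defined.
- move=> phi tau1 phi_neq0 phi_rec tau1_neq0 wd h_real phi0_real.
  have normE : `|tau1| = 1 <-> tau1 * Num.conj tau1 = 1.
    rewrite -normCK; split=> [->|]; first by rewrite expr1n.
    by move/eqP; rewrite sqrp_eq1 ?normr_ge0 // => /eqP.
  rewrite normE; split; first exact: star_preserving_tau0.
  move=> tau1_norm; have [e1 e2 e3 e4 e5] :=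
    star_equations h_neq0 phi_neq0 eps2 phi_rec wd h_real phi0_real eps_real
      tau1_norm.
  exact: coeff_star_preserving.
Qed.
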